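(* There exists no function $f:\mathbb{N}\to\mathbb{N}$ and deterministic algorithm $\mathcal{A}$ that solves the optimization problem $\max c^\top x$, $x\in P$ using at most $f(n)$ oracle calls for all $n$, all nonempty full-dimensional polyhedra $P\subseteq\mathbb{R}^n$ and all $c\in\mathbb{R}^n$, where $P$ is accessed only via the following oracle: for each queried $\bar x\in\mathbb{R}^n$, the oracle either returns that $\bar x\in P$, or returns a facet-defining inequality of $P$ violated by $\bar x$.
   Context: Solving the problem means finding an exact optimal solution $x\in P$ (or correctly concluding that the problem is unbounded). The algorithm knows $n$ and $c$, and obtains information on $P$ only from the answers to its (adaptive) oracle queries. *)

(* Defs.v *)
From mathcomp Require Import all_boot all_order all_algebra.
From mathcomp Require Import classical_sets reals.

Set Implicit Arguments.
Unset Strict Implicit.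
Unset Printing Implicit Defensive.

Import Order.TTheory GRing.Theory Num.Theory.
Local Open Scope classical_set_scope.
Local Open Scope ring_scope.

Definition dotp (R : realType) (n : nat) (a x : 'cV[R]_n) : R :=
  (a^T *m x) ord0 ord0.

Definition polyhedron (R : realType) (n : nat) (P : set 'cV[R]_n) : Prop :=
  exists (m : nat) (A : 'M[R]_(m, n)) (b : 'cV[R]_m),
    P = [set x | forall i : 'I_m, (A *m x) i ord0 <= b i ord0].

Definition affinely_independent (R : realType) (n k : nat)
    (p : 'I_k -> 'cV[R]_n) : Prop :=
  forall w : 'I_k -> R,
    \sum_i w i = 0 -> \sum_i w i *: p i = 0 -> forall i, w i = 0.

(* The dimension of S is the maximum number of affinely independent points of
   S, minus one; in particular the empty set has dimension -1. *)
Definition has_dim (R : realType) (n : nat) (S : set 'cV[R]_n) (d : int) : Prop :=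
  exists k : nat,
    [/\ d = k%:Z - 1,
        exists2 p : 'I_k -> 'cV[R]_n,
          affinely_independent p & forall i, S (p i)
      & forall p : 'I_k.+1 -> 'cV[R]_n,
          (forall i, S (p i)) -> ~ affinely_independent p].

Definition full_dimensional (R : realType) (n : nat) (P : set 'cV[R]_n) : Prop :=
  has_dim P n%:Z.

Definition valid_inequality (R : realType) (n : nat) (P : set 'cV[R]_n)
    (a : 'cV[R]_n) (b : R) : Prop :=
  forall x, P x -> dotp a x <= b.

Definition facet_defining (R : realType) (n : nat) (P : set 'cV[R]_n)
    (a : 'cV[R]_n) (b : R) : Prop :=
  valid_inequality P a b /\
  exists2 d : int, has_dim P d & has_dim (P `&` [set x | dotp a x = b]) (d - 1).

(* [Violated a b] stands for the inequality a^T x <= b. *)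
Inductive answer (R : realType) (n : nat) : Type :=
  | Member
  | Violated of 'cV[R]_n & R.
Arguments Member {R n}.

Definition facet_oracle (R : realType) (n : nat) (P : set 'cV[R]_n)
    (O : 'cV[R]_n -> answer R n) : Prop :=
  forall x, match O x with
            | Member => P x
            | Violated a b => facet_defining P a b /\ b < dotp a x
            end.

Inductive output (R : realType) (n : nat) : Type :=
  | Optimal of 'cV[R]_n
  | Unbounded.
Arguments Unbounded {R n}.

Definition correct_output (R : realType) (n : nat) (P : set 'cV[R]_n)
    (c : 'cV[R]_n) (o : output R n) : Prop :=
  match o with
  | Optimal x => P x /\ forall y, P y -> dotp c y <= dotp c x
  | Unbounded => forall M : R, exists2 y, P y & M < dotp c y
  end.

Inductive action (R : realType) (n : nat) : Type :=
  | Query of 'cV[R]_n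
  | Stop of output R n.

(* Queries made so far together with their answers, oldest first. *)
Definition transcript (R : realType) (n : nat) : Type :=
  seq ('cV[R]_n * answer R n).

(* The next action is an arbitrary function of n, c and the transcript; no
   computability or running-time restriction is imposed, only oracle calls are
   counted. *)
Definition algorithm (R : realType) : Type :=
  forall n : nat, 'cV[R]_n -> transcript R n -> action R n.

(* The output reached from transcript h with at most k further oracle calls,
   or None if the algorithm asks for more than k. *)
Fixpoint run (R : realType) (n : nat) (next : transcript R n -> action R n)
    (O : 'cV[R]_n -> answer R n) (k : nat) (h : transcript R n) :
    option (output R n) :=
  match next h with
  | Stop o => Some o
  | Query x => if k is k'.+1 then run next O k' (rcons h (x, O x)) else None
  end.

(* P may admit several facet oracles (choice of facet and of scaling); the
   algorithm has to succeed with each of them. *)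
Definition solves_within (R : realType) (A : algorithm R) (f : nat -> nat) : Prop :=
  forall (n : nat) (P : set 'cV[R]_n) (c : 'cV[R]_n)
         (O : 'cV[R]_n -> answer R n),
    polyhedron P -> P !=set0 -> full_dimensional P -> facet_oracle P O ->
    exists2 o : output R n,
      run (A n c) O (f n) [::] = Some o & correct_output P c o.

(* Main.v *)
(** The obstruction already occurs for [n = 1] and [c = 1]. If every query is
    answered "in [P]", the answers are those of [P = R], so the algorithm must
    conclude that the problem is unbounded. It has made finitely many queries,
    so all answers are also those of the half-line [x <= M] for [M] above every
    query, for which that conclusion is wrong. *)

Require Import Defs.
From mathcomp Require Import all_boot all_order all_algebra.
From mathcomp Require Import classical_sets reals.

Set Implicit Arguments.
Unset Strict Implicit.
Unset Printing Implicit Defensive.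

Import Order.TTheory GRing.Theory Num.Theory.
Local Open Scope classical_set_scope.
Local Open Scope ring_scope.

(** With [O] fixed, the run follows a single path of at most [k] queries, and [s] collects them.
    Each action depends only on the transcript, so an oracle that agrees with [O] on [s] is led
    along the same path. *)
Lemma run_finitely_many_queries (R : realType) (n : nat)
    (next : transcript R n -> action R n) (O : 'cV[R]_n -> answer R n)
    (k : nat) (h : transcript R n) :
  exists s : seq 'cV[R]_n, forall O' : 'cV[R]_n -> answer R n,
    {in s, O' =1 O} -> run next O' k h = run next O k h.
Proof.
elim: k h => [|k IH] h /=; first by exists [::].
case: (next h) => [x|o]; last by exists [::].
have [s Hs] := IH (rcons h (x, O x)).
exists (x :: s) => O' eqO; rewrite eqO ?mem_head//.
by apply: Hs => y ys; apply: eqO; rewrite inE ys orbT.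
Qed.

Lemma seq_ubound (R : numDomainType) (T : eqType) (g : T -> R) (s : seq T) :
  (forall x, g x \is Num.real) -> exists M, forall x, x \in s -> g x <= M.
Proof.
(* A sum of absolute values dominates each of its terms, and it covers the empty list without a case
   split. *)
move=> g_real; exists (\sum_(y <- s) `|g y|) => x xs.
rewrite (big_rem x)//= (le_trans (real_ler_norm (g_real x)))// lerDl.
by rewrite sumr_ge0.
Qed.

Lemma affinely_dependent (R : realType) (n : nat) (p : 'I_n.+2 -> 'cV[R]_n) :
  ~ affinely_independent p.
Proof.
(* A nonzero vector in the left kernel of the (n+2) x (1+n) matrix whose rows
   are [(1, p i)] is an affine dependence. *)
pose B : 'M[R]_(n.+2, 1 + n) := row_mx (const_mx 1) (\matrix_i (p i)^T).
have /rowV0Pn[w /sub_kermxP wB /eqP w0] : kermx B != 0.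
  by rewrite -mxrank_eq0 mxrank_ker subn_eq0 -ltnNge ltnS rank_leq_col.
move=> indep; apply: w0; apply/rowP => i; rewrite mxE.
move: wB; rewrite mul_mx_row -row_mx0 => /eq_row_mx[wB1 wB2].
apply: (indep (fun i => w ord0 i)).
  move/matrixP: wB1 => /(_ ord0 ord0); rewrite !mxE => E.
  by rewrite -[RHS]E; apply: eq_bigr => j _; rewrite mxE mulr1.
apply/colP => j; move/matrixP: wB2 => /(_ ord0 j); rewrite !mxE => E.
rewrite summxE -[RHS]E; apply: eq_bigr => l _; by rewrite !mxE.
Qed.

Lemma full_dimensionalI (R : realType) (n : nat) (S : set 'cV[R]_n)
    (p : 'I_n.+1 -> 'cV[R]_n) :
  affinely_independent p -> (forall i, S (p i)) -> full_dimensional S.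
Proof.
move=> indep Sp; exists n.+1; split; first by rewrite -addn1 PoszD addrK.
  by exists p.
by move=> q _; apply: affinely_dependent.
Qed.

Lemma has_dim_set1 (R : realType) (n : nat) (x : 'cV[R]_n) :
  has_dim [set x] 0.
Proof.
exists 1%N; split; first by rewrite subrr.
  exists (fun=> x) => // w; rewrite big_ord1 => w0 _ i.
  by rewrite (ord1 i).
(* Both points equal [x], so the weights 1 and -1 give an affine dependence. *)
move=> p px /(_ (fun i => if i == ord0 then 1 else -1)).
rewrite !big_ord_recl !big_ord0 /= !px !addr0 scale1r scaleN1r !subrr.
by move=> /(_ erefl erefl ord0)/eqP; rewrite oner_eq0.
Qed.

Definition halfline (R : realType) (M : R) : set 'cV[R]_1 :=
  [set x | x ord0 ord0 <= M].

Lemma polyhedron_halfline (R : realType) (M : R) : polyhedron (halfline M).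
Proof.
exists 1%N, 1%:M, (const_mx M); apply/seteqP; split => x /=.
  by move=> xM i; rewrite mul1mx mxE (ord1 i).
by move=> /(_ ord0); rewrite mul1mx mxE.
Qed.

Lemma polyhedron_setT (R : realType) (n : nat) :
  polyhedron [set: 'cV[R]_n].
Proof.
(* The whole space is cut out by the system with no rows. *)
by exists 0%N, 0, 0; apply/seteqP; split => x // _ [].
Qed.

(** Stated for supersets so that it serves both the half-line and the whole line. The points [M] and
    [M - 1] are the two affinely independent witnesses. *)
Lemma full_dimensional_superset_halfline (R : realType) (M : R)
    (S : set 'cV[R]_1) :
  halfline M `<=` S -> full_dimensional S.
Proof.
move=> sub.
apply: (@full_dimensionalI _ _ _ (fun i => const_mx (M - (i : nat)%:R))).
  move=> w; rewrite !big_ord_recl !big_ord0 !addr0 /= => w0 /colP/(_ ord0).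
  rewrite !mxE subr0 mulrBr mulr1 addrA -mulrDl w0 mul0r add0r => /eqP.
  rewrite oppr_eq0 => /eqP w1; move: w0; rewrite w1 addr0 => w0 i.
  case: (unliftP ord0 i) => [j ->|-> //]; by rewrite (ord1 j).
by move=> i; apply: sub; rewrite /halfline /= mxE gerBl.
Qed.

Lemma dotp_const1 (R : realType) (x : 'cV[R]_1) :
  dotp (const_mx 1) x = x ord0 ord0.
Proof. by rewrite /dotp mxE big_ord1 !mxE mul1r. Qed.

Lemma facet_defining_halfline (R : realType) (M : R) :
  facet_defining (halfline M) (const_mx 1) M.
Proof.
split; first by move=> x; rewrite dotp_const1.
(* The face is the endpoint alone, of dimension 0 = 1 - 1. *)
exists 1; first exact: (@full_dimensional_superset_halfline _ M).
suff -> : halfline M `&` [set x | dotp (const_mx 1) x = M] = [set const_mx M].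
  by rewrite subrr; apply: has_dim_set1.
apply/seteqP; split => x /=; rewrite dotp_const1.
  by case=> _ xM; apply/matrixP => i j; rewrite !ord1 mxE.
by move=> ->; rewrite /halfline /= mxE.
Qed.

Definition halfline_oracle (R : realType) (M : R) (x : 'cV[R]_1) : answer R 1 :=
  if x ord0 ord0 <= M then Member else Violated (const_mx 1) M.

Lemma facet_oracle_halfline (R : realType) (M : R) :
  facet_oracle (halfline M) (halfline_oracle M).
Proof.
move=> x; rewrite /halfline_oracle; case: leP => // Mx; split.
  exact: facet_defining_halfline.
by rewrite dotp_const1.
Qed.

Theorem proposition1p1 (R : realType) :
  ~ exists (f : nat -> nat) (A : algorithm R), solves_within A f.
Proof.
move=> [f [A solves]].
pose c : 'cV[R]_1 := const_mx 1; pose OT : 'cV[R]_1 -> answer R 1 := fun=> Member.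
have [||||o runT] := solves 1%N setT c OT.
- exact: polyhedron_setT.
- by exists 0.
- exact: (@full_dimensional_superset_halfline _ 0).
- by [].
(* On the whole line [x + c] beats any claimed optimum [x]. *)
case: o runT => [x _ [_ /(_ (x + c) I)]|runT _].
  by rewrite !dotp_const1 !mxE gerDl ler10.
have [s agree] := run_finitely_many_queries (A 1%N c) OT (f 1%N) [::].
have [M leM] := seq_ubound s (fun x : 'cV[R]_1 => num_real (x ord0 ord0)).
have [||||o] := solves 1%N (halfline M) c (halfline_oracle M).
- exact: polyhedron_halfline.
- by exists (const_mx M); rewrite /halfline /= mxE.
- exact: (@full_dimensional_superset_halfline _ M).
- exact: facet_oracle_halfline.
(* Every query in [s] is at most [M], so [halfline_oracle M] answers [Member] there, as [OT]
   does. *)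
rewrite agree => [|x xs]; last by rewrite /halfline_oracle leM.
(* Unboundedness is tested at the threshold [M], which no point of the half-line exceeds. *)
rewrite runT => -[<-] /(_ M)[y yM].
by rewrite dotp_const1 ltNge yM.
Qed.
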